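(* Let $G$ be a $2$-regular graph with $n$ vertices, where $n\geq 9$. Then the complement $\overline{G}$ is divergent.
   Context: All graphs are finite and simple. A clique is a maximal set of pairwise adjacent vertices. The clique graph $K(G)$ is the intersection graph of the cliques of $G$. Iterated clique graphs: $K^0(G)=G$, $K^n(G)=K(K^{n-1}(G))$ for $n\ge 1$. $G$ is convergent if the sequence $(K^n(G))_{n\ge0}$ contains only finitely many graphs up to isomorphism, and divergent otherwise. *)

(* Defs.v *)
From mathcomp Require Import all_boot.
Set Implicit Arguments. Unset Strict Implicit. Unset Printing Implicit Defensive.

Record graph := Graph {
  vert : finType;
  adj : rel vert;
  adj_sym : symmetric adj;
  adj_irr : irreflexive adj }.

Definition complete (G : graph) (A : {set vert G}) : bool :=
  [forall x in A, forall y in A, (x != y) ==> adj x y].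

Definition is_clique (G : graph) (A : {set vert G}) : bool :=
  complete A && [forall B : {set vert G}, (A \proper B) ==> ~~ complete B].

Definition clique_type (G : graph) : finType := {A : {set vert G} | is_clique A}.

Definition kadj (G : graph) : rel (clique_type G) :=
  fun C D => (C != D) && (val C :&: val D != set0).

Lemma kadj_sym (G : graph) : symmetric (@kadj G).
Proof. by move=> C D; rewrite /kadj eq_sym setIC. Qed.

Lemma kadj_irr (G : graph) : irreflexive (@kadj G).
Proof. by move=> C; rewrite /kadj eqxx. Qed.

Definition K (G : graph) : graph := @Graph (clique_type G) (@kadj G) (@kadj_sym G) (@kadj_irr G).

Fixpoint iterK (n : nat) (G : graph) : graph :=
  match n with 0 => G | m.+1 => K (iterK m G) end.

Definition isomorphic (G H : graph) : Prop :=
  exists f : vert G -> vert H, bijective f /\ forall x y, adj (f x) (f y) = adj x y.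

(* convergent: the sequence (K^n G)_n has only finitely many isomorphism
   classes, i.e. every term is isomorphic to one of the first N terms. *)
Definition convergent (G : graph) : Prop :=
  exists N : nat, forall n : nat, exists2 m : nat, m < N & isomorphic (iterK n G) (iterK m G).

Definition divergent (G : graph) : Prop := ~ convergent G.

Definition compl_adj (G : graph) : rel (vert G) := fun x y => (x != y) && ~~ adj x y.

Lemma compl_sym (G : graph) : symmetric (@compl_adj G).
Proof. by move=> x y; rewrite /compl_adj eq_sym adj_sym. Qed.

Lemma compl_irr (G : graph) : irreflexive (@compl_adj G).
Proof. by move=> x; rewrite /compl_adj eqxx. Qed.

Definition compl (G : graph) : graph := @Graph (vert G) (@compl_adj G) (@compl_sym G) (@compl_irr G).

Definition degree (G : graph) (v : vert G) : nat := #|[set u | adj v u]|.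

Definition regular (G : graph) (k : nat) : Prop := forall v : vert G, degree v = k.

(* Main.v *)
Require Import Defs.
From mathcomp Require Import all_boot.
Set Implicit Arguments. Unset Strict Implicit. Unset Printing Implicit Defensive.

(** The argument is a variant of Neumann-Lara's theory of expansive graphs. A
coaffination (an automorphism moving every vertex to a distinct non-adjacent
one) passes to clique graphs. Suppose that A_0, ..., A_{k-1} are non-empty
invariant vertex sets such that vertices of different sets are always adjacent;
invariance makes them disjoint. In K^2 the cliques containing the star of a
vertex of A_i again form such a family, and if every vertex of every A_i is
adjacent to two vertices of a triangle abc, the cliques containing a "majority"
{q : q contains two of a, b, c} form one more set. If A_0 contains an edge yz
such that each of its vertices is adjacent to y or z, then x, y, z is such a
triangle for any x in A_1, so the number of sets grows without bound.

A rotation of the cycles of G is a coaffination of the complement. Starting from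
the single set A_0 of all vertices, a first triangle is given by three vertices
with pairwise disjoint closed neighbourhoods in G. When n >= 9 they exist unless
G is C_4 + C_5 or C_5 + C_5, and then a triangle is found in the clique graph of
the complement. *)

(** * Reflexive adjacency and cliques *)

(** Equality is allowed so that two cliques of a non-empty graph are [weq] in the clique graph
    exactly when they meet. *)
Definition weq (H : graph) (x y : vert H) : bool := (x == y) || adj x y.

Lemma weqxx (H : graph) (x : vert H) : weq x x.
Proof. by rewrite /weq eqxx. Qed.

Lemma weq_sym (H : graph) (x y : vert H) : weq x y = weq y x.
Proof. by rewrite /weq eq_sym adj_sym. Qed.

Lemma completeP (H : graph) (A : {set vert H}) :
  reflect {in A &, forall x y, weq x y} (complete A).
Proof.
apply: (iffP idP) => [/forall_inP cA x y xA yA | cA].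
  by move/forall_inP: (cA x xA) => /(_ y yA); rewrite /weq; case: eqP.
apply/forall_inP => x xA; apply/forall_inP => y yA; apply/implyP => nxy.
by have := cA x y xA yA; rewrite /weq (negPf nxy).
Qed.

Lemma exists_clique (H : graph) (B : {set vert H}) :
  complete B -> exists C : vert (K H), B \subset val C.
Proof.
move=> cB; have [A /maxsetP [cA maxA] sBA] := @maxset_exists _ (@complete H) B cB.
have clA : is_clique A.
  rewrite /is_clique cA; apply/forall_inP => D /properP [sAD [x xD xA]].
  by apply/negP => cD; rewrite -(maxA D cD sAD) xD in xA.
by exists (Sub A clA); rewrite SubK.
Qed.

Lemma clique_complete (H : graph) (C : vert (K H)) : complete (val C).
Proof. by have /andP [] := valP C. Qed.

Lemma clique_maximal (H : graph) (C : vert (K H)) (v : vert H) :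
  {in val C, forall u, weq v u} -> v \in val C.
Proof.
move=> adjv; apply/negPn/negP => vC; have /andP [cC /forall_inP maxC] := valP C.
have pC : val C \proper v |: val C.
  by apply/properP; split; [exact: subsetUr | exists v; rewrite ?setU11].
have /negP := maxC _ pC; apply; apply/completeP => x y; rewrite !inE.
case/orP => [/eqP-> | xC] /orP [/eqP-> | yC]; rewrite ?weqxx ?adjv //.
  by rewrite weq_sym adjv.
exact: (completeP _ cC).
Qed.

Lemma weqK (H : graph) (C D : vert (K H)) (x : vert H) :
  x \in val C -> x \in val D -> weq C D.
Proof.
move=> xC xD; rewrite /weq /= /kadj; case: eqP => //= _.
by apply/set0Pn; exists x; rewrite inE xC.
Qed.

(** [x0] keeps cliques non-empty: the empty set is maximal only in the empty graph. *)
Lemma weqK_meet (H : graph) (x0 : vert H) (C D : vert (K H)) :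
  weq C D -> exists2 x, x \in val C & x \in val D.
Proof.
case/orP => [/eqP <- | /andP [_ /set0Pn [x]]]; last first.
  by rewrite inE => /andP []; exists x.
have [C0|/set0Pn [x xC]] := eqVneq (val C) set0; last by exists x.
suff: x0 \in val C by rewrite C0 inE.
by apply: clique_maximal => u; rewrite C0 inE.
Qed.

(** * Coaffinations of clique graphs *)

Definition coaffination (H : graph) (s : vert H -> vert H) : Prop :=
  [/\ injective s, {mono s : x y / adj x y} & forall x, ~~ weq x (s x)].

Lemma coaff_weq (H : graph) (s : vert H -> vert H) :
  coaffination s -> {mono s : x y / weq x y}.
Proof. by case=> injs adjs _ x y; rewrite /weq adjs (inj_eq injs). Qed.

(* [x0] excludes the empty graph, whose clique graph is one vertex without coaffination. *)
Lemma coaffinationK (H : graph) (x0 : vert H) (s : vert H -> vert H) :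
  coaffination s ->
  exists2 t : vert (K H) -> vert (K H), coaffination t &
    forall C, val (t C) = s @: val C.
Proof.
move=> cs; have mw := coaff_weq cs; case: (cs) => injs adjs nws.
have [s' sK s'K] := injF_bij injs.
have clS (C : vert (K H)) : exists D : vert (K H), s @: val C == val D.
  have /exists_clique [D sCD] : complete (s @: val C).
    apply/completeP => _ _ /imsetP [x xC ->] /imsetP [y yC ->]; rewrite mw.
    exact: (completeP _ (clique_complete C)).
  exists D; rewrite eqEsubset sCD; apply/subsetP => x xD.
  rewrite -[x]s'K imset_f //; apply: clique_maximal => u uC.
  rewrite -mw s'K; apply: (completeP _ (clique_complete D)) => //.
  by apply: (subsetP sCD); rewrite imset_f.
pose t C := xchoose (clS C).
have tE C : val (t C) = s @: val C by rewrite -(eqP (xchooseP (clS C))).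
exists t => //; have injt : injective t.
  by move=> C D eCD; apply/val_inj/(imset_inj injs); rewrite -!tE eCD.
split=> // [C D|C].
  rewrite /= /kadj (inj_eq injt) !tE -imsetI; last by move=> ? ? _ _; apply: injs.
  by rewrite imset_eq0.
apply/negP => /(weqK_meet x0) [x xC]; rewrite tE => /imsetP [y yC xy].
have /negP [] := nws y; rewrite -xy.
exact: (completeP _ (clique_complete C)).
Qed.

(** * Stars, majorities and the cliques above them *)

Definition star (H : graph) (x : vert H) : {set vert (K H)} :=
  [set q : vert (K H) | x \in val q].

Definition two_of (T : Type) (P : T -> bool) (a b c : T) : bool :=
  [|| P a && P b, P a && P c | P b && P c].

Definition majority (H : graph) (a b c : vert H) : {set vert (K H)} :=
  [set q : vert (K H) | two_of (fun x => x \in val q) a b c].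

Definition good_triple (H : graph) (A : {set vert H}) (a b c : vert H) : bool :=
  [&& weq a b, weq a c, weq b c & [forall v in A, two_of (weq v) a b c]].

Definition above (H : graph) (F : {set {set vert H}}) : {set vert (K H)} :=
  [set q : vert (K H) | [exists S in F, S \subset val q]].

Lemma above_neq0 (H : graph) (F : {set {set vert H}}) (S : {set vert H}) :
  S \in F -> complete S -> above F != set0.
Proof.
move=> SF /exists_clique [q Sq]; apply/set0Pn; exists q.
by rewrite inE; apply/existsP; exists S; rewrite SF.
Qed.

Lemma weq_above (H : graph) (F F' : {set {set vert H}}) :
  (forall S S', S \in F -> S' \in F' -> exists2 x, x \in S & x \in S') ->
  forall q r, q \in above F -> r \in above F' -> weq q r.
Proof.
move=> FF' q r; rewrite !inE => /exists_inP [S SF Sq] /exists_inP [S' S'F S'r].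
have [x xS xS'] := FF' _ _ SF S'F.
exact: weqK (subsetP Sq x xS) (subsetP S'r x xS').
Qed.

Lemma star_complete (H : graph) (x : vert H) : complete (star x).
Proof. by apply/completeP => q r; rewrite !inE; apply: weqK. Qed.

(** Two pairs taken from three positions share a position, so any two members meet in one of [a],
    [b], [c]. *)
Lemma majority_complete (H : graph) (a b c : vert H) : complete (majority a b c).
Proof.
apply/completeP => q r; rewrite !inE.
by case/or3P => /andP [h1 h2] /or3P [] /andP [h3 h4];
  first [exact: weqK h1 h3 | exact: weqK h1 h4 | exact: weqK h2 h3 | exact: weqK h2 h4].
Qed.

Lemma star_meet (H : graph) (x y : vert H) :
  weq x y -> exists2 q, q \in star x & q \in star y.
Proof.
move=> xy; have /exists_clique [q /subsetP sq] : complete [set x; y].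
  by apply/completeP => u v /set2P [] -> /set2P [] ->; rewrite ?weqxx // weq_sym.
by exists q; rewrite inE sq // !inE eqxx ?orbT.
Qed.

(** [v] and two of [a], [b], [c] that are [weq] to it form a complete set; a clique containing it is
    in both sets. *)
Lemma star_majority_meet (H : graph) (A : {set vert H}) (v a b c : vert H) :
  good_triple A a b c -> v \in A ->
  exists2 q, q \in star v & q \in majority a b c.
Proof.
case/and4P => ab ac bc /forall_inP AP vA.
have meet x y : weq x y -> weq v x -> weq v y ->
    exists q : vert (K H), [/\ v \in val q, x \in val q & y \in val q].
  move=> xy vx vy; have /exists_clique [q /subsetP sq] : complete [set v; x; y].
    apply/completeP => i j; rewrite !inE -!orbA => /or3P [] /eqP -> /or3P [] /eqP ->;
    by rewrite ?weqxx // weq_sym.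
  by exists q; split; apply: sq; rewrite !inE eqxx ?orbT.
have := AP v vA; rewrite /two_of => /or3P [] /andP [h1 h2].
- have [q [vq h3 h4]] := meet a b ab h1 h2.
  by exists q; rewrite inE // /two_of h3 h4.
- have [q [vq h3 h4]] := meet a c ac h1 h2.
  by exists q; rewrite inE // /two_of h3 h4 orbT.
- have [q [vq h3 h4]] := meet b c bc h1 h2.
  by exists q; rewrite inE // /two_of h3 h4 !orbT.
Qed.

Lemma above_stable (H : graph) (s : vert H -> vert H) (t : vert (K H) -> vert (K H))
    (F : {set {set vert H}}) :
  (forall C, val (t C) = s @: val C) ->
  (forall S, S \in F -> s @: S \in F) ->
  forall q, q \in above F -> t q \in above F.
Proof.
move=> tE sF q; rewrite !inE => /exists_inP [S SF Sq]; apply/exists_inP.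
by exists (s @: S); rewrite ?sF // tE imsetS.
Qed.

(** * Layered graphs and the growth of the number of layers *)

(** Only the [A i] with [i < k] matter. The pair [y], [z] dominating [A 0] provides two vertices of
    the next triangle. *)
Definition layers (H : graph) (k : nat) (s : vert H -> vert H) (A : nat -> {set vert H}) :=
  [/\ coaffination s,
      forall i x, i < k -> x \in A i -> s x \in A i,
      forall i, i < k -> A i != set0,
      forall i j x y, i < j < k -> x \in A i -> y \in A j -> weq x y &
      exists y z, [/\ y \in A 0, z \in A 0, weq y z &
        forall v, v \in A 0 -> weq v y || weq v z]].

Definition layered (H : graph) (k : nat) : Prop := exists s A, @layers H k s A.

(** Layers are disjoint: if [x] were in two of them, [s x] would be in the second and hence [weq] to
    [x]. So representatives of the layers are distinct. *)
Lemma layered_card (H : graph) (k : nat) : layered H k -> k <= #|vert H|.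
Proof.
case=> s [A [[_ _ nws] sA A0 AA _]].
have [->//|k0] := posnP k.
have /set0Pn [x0 _] := A0 0 k0.
pose f (i : 'I_k) := odflt x0 [pick x in A i].
have fA i : f i \in A i.
  rewrite /f; case: pickP => //= nA.
  by have /set0Pn [x] := A0 i (ltn_ord i); rewrite nA.
rewrite -{1}(card_ord k) -(card_codom (f := f)) ?max_card // => i j eij.
have disj (i1 j1 : 'I_k) : i1 < j1 -> f i1 = f j1 -> False.
  move=> lt e; have /negP := nws (f i1); apply.
  by apply: (AA i1 j1); rewrite ?lt ?ltn_ord // e sA.
apply: val_inj => /=; case: (ltngtP i j) => // lt; first by case: (disj i j).
by case: (disj j i).
Qed.

Lemma layered_step (H : graph) (k : nat) (s : vert H -> vert H) (A : nat -> {set vert H})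
    (a b c : vert H) :
  0 < k -> layers k s A -> (forall i, i < k -> good_triple (A i) a b c) ->
  layered (K (K H)) k.+1.
Proof.
move=> k0 [cs sA A0 AA [y [z [yA zA yz dom]]]] abc.
have [t ct tE] := coaffinationK y cs.
have [q0 _ _] := star_meet yz.
have [u cu uE] := coaffinationK q0 ct.
have injs : injective s by case: cs.
have injt : injective t by case: ct.
have [s' sK s'K] := injF_bij injs.
have [t' tK t'K] := injF_bij injt.
have mw := coaff_weq cs.
have inK x q : (s x \in val (t q)) = (x \in val q) by rewrite tE mem_imset.
have starE x : t @: star x = star (s x).
  apply/setP => q; rewrite -[q]t'K mem_imset // !inE; exact/esym/inK.
have majE x1 x2 x3 : t @: majority x1 x2 x3 = majority (s x1) (s x2) (s x3).
  by apply/setP => q; rewrite -[q]t'K mem_imset // !inE /two_of !inK.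
(* An injection of the finite set [A i] into itself is onto, so the inverse preserves [A i] too. *)
have sA' i x : i < k -> x \in A i -> s' x \in A i.
  move=> ik xA; have sAi : s @: A i = A i.
    apply/eqP; rewrite eqEcard card_imset // leqnn andbT.
    by apply/subsetP => _ /imsetP [w wA ->]; apply: sA.
  by rewrite -sAi in xA; case/imsetP: xA => w wA ->; rewrite sK.
pose F i := [set star x | x in A i].
pose M := [set majority w.1.1 w.1.2 w.2 | w : vert H * vert H * vert H
  & [forall i : 'I_k, good_triple (A i) w.1.1 w.1.2 w.2]].
pose B i := if i < k then above (F i) else above M.
exists u, B; split => //.
- move=> i x _; rewrite /B; case: ltnP => ik; apply: (above_stable uE).
    by move=> S /imsetP [w wA ->]; rewrite starE imset_f // sA.
  move=> S /imsetP [[[w1 w2] w3] /=]; rewrite inE /= => /forallP gw ->.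
  rewrite majE; apply/imsetP; exists (s w1, s w2, s w3) => //=.
  rewrite inE /=; apply/forallP => j; have /and4P [h1 h2 h3 /forall_inP h4] := gw j.
  rewrite /good_triple !mw h1 h2 h3 /=; apply/forall_inP => v vA.
  by rewrite -[v]s'K /two_of !mw; apply/h4/sA'.
- move=> i _; rewrite /B; case: ltnP => ik.
    have /set0Pn [x xA] := A0 i ik.
    by apply: (above_neq0 (S := star x)); rewrite ?imset_f ?star_complete.
  apply: (above_neq0 (S := majority a b c)); rewrite ?majority_complete //.
  apply/imsetP; exists (a, b, c) => //; rewrite inE /=.
  by apply/forallP => j; apply: abc.
- move=> i j q r /andP [ij jk]; rewrite /B.
  have ik : i < k by apply: leq_trans ij _.
  rewrite ik; case: ltnP => jk'; apply: weq_above => S S' /imsetP [x xA ->].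
    by case/imsetP => x' x'A ->; apply: star_meet; apply: (AA i j); rewrite ?ij.
  case/imsetP => w; rewrite inE => /forallP gw ->.
  exact: star_majority_meet (gw (Ordinal ik)) xA.
(* The new dominating pair: if [v] is [weq] to [y], some clique lies in both stars, so whatever
   contains the star of [v] meets [Y]; likewise for [z] and [Z]. *)
have [Y Yy] := exists_clique (star_complete y).
have [Z Zz] := exists_clique (star_complete z).
have FB x (Q : vert (K (K H))) : x \in A 0 -> star x \subset val Q -> Q \in B 0.
  by rewrite /B k0 inE => xA xQ; apply/exists_inP; exists (star x); rewrite ?imset_f.
exists Y, Z; split; [exact: FB yA Yy | exact: FB zA Zz | |].
  have [q qy qz] := star_meet yz.
  exact: weqK (subsetP Yy q qy) (subsetP Zz q qz).
move=> V; rewrite /B k0 inE => /exists_inP [_ /imsetP [v vA ->] vV].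
case/orP: (dom v vA) => /star_meet [q q1 q2]; apply/orP.
  by left; apply: weqK (subsetP vV q q1) (subsetP Yy q q2).
by right; apply: weqK (subsetP vV q q1) (subsetP Zz q q2).
Qed.

Lemma layered_succ (H : graph) (k : nat) :
  1 < k -> layered H k -> layered (K (K H)) k.+1.
Proof.
move=> k1 [s [A LA]]; have := LA; case=> _ _ A0 AA [y [z [yA zA yz dom]]].
have /set0Pn [x xA] := A0 1 k1.
(* A vertex of [A 0] sees [x] and one of [y], [z]; a vertex of any other layer sees both [y] and
   [z]. *)
apply: (@layered_step H k s A x y z) => [|//|i ik]; first exact: ltnW.
have xw v : v \in A 0 -> weq v x by move=> vA; apply: (AA 0 1).
apply/and4P; split; rewrite ?yz //; try by rewrite weq_sym xw.
apply/forall_inP => v vA; rewrite /two_of.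
have [i0|i0] := posnP i.
  by rewrite i0 in vA; rewrite xw //=; case/orP: (dom v vA) => ->; rewrite ?orbT.
have wv w : w \in A 0 -> weq v w by move=> wA; rewrite weq_sym; apply: (AA 0 i); rewrite ?i0.
by rewrite (wv y yA) (wv z zA) !orbT.
Qed.

(** * Unbounded orders and divergence *)

Definition unbounded (H : graph) : Prop :=
  forall N, exists n, N <= #|vert (iterK n H)|.

Lemma good_triple_unbounded (H : graph) (s : vert H -> vert H) (a b c : vert H) :
  coaffination s -> good_triple setT a b c -> unbounded H.
Proof.
move=> cs gt N.
have L1 : layers 1 s (fun=> [set: vert H]).
  split=> //; first by move=> i _; apply/set0Pn; exists a.
    by move=> i [|j] x y /andP [].
  (* Two of [a], [b], [c] always include [a] or [b], so this pair dominates. *)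
  case/and4P: gt => ab _ _ /forall_inP dom; exists a, b; split=> // v vT.
  by have := dom v vT; case/or3P => /andP [-> _]; rewrite ?orbT.
(* Each double step adds a layer to the initial one, giving [N.+2] layers. The first uses the given
   triple, since [layered_succ] requires two layers. *)
exists (N.+1).*2; apply: (@leq_trans N.+2) (layered_card _); first by rewrite -addn2 leq_addr.
elim: N => [|N IHN]; first exact: layered_step (ltn0Sn 0) L1 (fun _ _ => gt).
exact: layered_succ IHN.
Qed.

Lemma iterKS (n : nat) (H : graph) : iterK n (K H) = iterK n.+1 H.
Proof. by elim: n => //= n ->. Qed.

Lemma unboundedK (H : graph) : unbounded (K H) -> unbounded H.
Proof. by move=> uK N; have [n] := uK N; rewrite iterKS; exists n.+1. Qed.

Lemma unbounded_divergent (H : graph) : unbounded H -> divergent H.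
Proof.
move=> uH [N cN]; have [n] := uH (\max_(i < N) #|vert (iterK i H)|).+1.
have [m mN [f [bf _]]] := cN n.
rewrite (bij_eq_card bf) ltnNge => /negP []; exact: (leq_bigmax (Ordinal mN)).
Qed.

(** * Orienting a 2-regular graph *)

Section Rotation.

Variables (G : graph) (regG : regular G 2).

Let two_nbrs (v : vert G) : exists a b, a != b /\ forall u, adj v u = (u == a) || (u == b).
Proof.
have /eqP/cards2P [a [b [nab E]]] := regG v.
by exists a, b; split=> // u; move/setP/(_ u): E; rewrite !inE.
Qed.

Definition other_nbr (u v : vert G) : vert G := odflt u [pick w | adj v w && (w != u)].

Lemma other_nbrP (u v : vert G) : adj u v ->
  [/\ adj v (other_nbr u v), other_nbr u v != u &
      forall w, adj v w -> w = u \/ w = other_nbr u v].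
Proof.
rewrite adj_sym => vu; have [a [b [nab E]]] := two_nbrs v.
rewrite /other_nbr; case: pickP => [w /andP [vw wu]|no] /=.
  split=> // x vx; move: vu vw vx wu; rewrite !E.
  by do 3!case/orP => /eqP ->; rewrite ?eqxx //; move=> *; auto.
have := no a; have := no b; move: vu; rewrite !E !eqxx orbT /=.
by case/orP => /eqP ->; rewrite ?nab // eq_sym nab.
Qed.

(** One step along the cycle without turning back. Non-adjacent pairs are fixed, so this is a
    permutation of all pairs. *)
Definition next_dart (d : vert G * vert G) : vert G * vert G :=
  if adj d.1 d.2 then (d.2, other_nbr d.1 d.2) else d.

Definition rev_dart (d : vert G * vert G) : vert G * vert G := (d.2, d.1).

Lemma next_dart_adj (d : vert G * vert G) :
  adj (next_dart d).1 (next_dart d).2 = adj d.1 d.2.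
Proof.
case: d => u v; rewrite /next_dart /=; case: ifP => //= uv.
by have [->] := other_nbrP uv.
Qed.

Lemma next_dart_inj : injective next_dart.
Proof.
move=> [u v] [u' v'] E; have := next_dart_adj (u', v').
rewrite -E next_dart_adj /=; move: E; rewrite /next_dart /=.
case: ifP => uv E uv'; rewrite -uv' // in E.
case: E => ev E; subst v'; congr pair.
have [_ n1 cov] := other_nbrP uv; have [_ n2 _] := other_nbrP (esym uv').
by case: (cov u'); rewrite // 1?adj_sym -?uv' // => eu; rewrite -E eu eqxx in n2.
Qed.

(** Reversal conjugates the walk into its inverse. *)
Lemma next_rev_next (d : vert G * vert G) : next_dart (rev_dart (next_dart d)) = rev_dart d.
Proof.
case: d => u v; rewrite {2}/next_dart /=; case: ifP => uv; last first.
  by rewrite /rev_dart /next_dart /= adj_sym uv.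
have [a1 n1 cov] := other_nbrP uv; rewrite /rev_dart /next_dart /= adj_sym a1.
have wv : adj (other_nbr u v) v by rewrite adj_sym.
have [a2 n2 cov2] := other_nbrP wv; congr pair.
by case: (cov _ a2) => // e; rewrite e eqxx in n2.
Qed.

(* A reversed dart cannot be reached by walking on: halving the walk would
   give a dart equal to its own reverse, or a walk that turns back. *)
Lemma rev_dart_neq_iter (k : nat) (d : vert G * vert G) :
  adj d.1 d.2 -> iter k next_dart d <> rev_dart d.
Proof.
elim/ltn_ind: k d => [[|[|k]]] IH d ad.
- case: d ad => u v /= uv [e _]; by rewrite e adj_irr in uv.
- case: d ad => u v /= uv; rewrite /next_dart /= uv => -[e].
  by have [_] := other_nbrP uv; rewrite e eqxx.
rewrite -next_rev_next iterS => /next_dart_inj; rewrite iterSr.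
by apply: IH; rewrite ?next_dart_adj.
Qed.

(* By [rev_dart_neq_iter], the orbits of a dart and of its reverse differ;
   selecting the one of smaller root orients every cycle. *)
Definition positive (d : vert G * vert G) : bool :=
  enum_rank (froot next_dart d) < enum_rank (froot next_dart (rev_dart d)).

Let csym := fconnect_sym next_dart_inj.

Lemma positive_next (d : vert G * vert G) : positive (next_dart d) = positive d.
Proof.
rewrite /positive.
have -> : froot next_dart (next_dart d) = froot next_dart d.
  by apply/esym/eqP; rewrite (root_connect csym) fconnect1.
suff -> : froot next_dart (rev_dart (next_dart d)) = froot next_dart (rev_dart d) by [].
by apply/eqP; rewrite (root_connect csym) -[rev_dart d]next_rev_next fconnect1.
Qed.

Lemma positive_rev (d : vert G * vert G) :
  adj d.1 d.2 -> positive (rev_dart d) = ~~ positive d.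
Proof.
case: d => u v /= uv; rewrite /positive /rev_dart /= -leqNgt [RHS]leq_eqVlt.
case: eqP => // e; have E := enum_rank_inj (val_inj e).
have /iter_findex : fconnect next_dart (u, v) (v, u) by rewrite -(root_connect csym) E.
by move/(rev_dart_neq_iter (d := (u, v)) uv).
Qed.

Definition rotation (v : vert G) : vert G := odflt v [pick w | adj v w && positive (v, w)].

(** If [a], [b] are the neighbours of [v], the dart [(a, v)] is followed by [(v, b)], of the same
    sign, while [(v, a)] has the opposite sign. So exactly one dart leaving [v] is positive. *)
Lemma rotationP (v : vert G) : [/\ adj v (rotation v), positive (v, rotation v) &
  forall w, adj v w -> positive (v, w) -> w = rotation v].
Proof.
have turn a b : adj v a -> adj v b -> a != b -> positive (v, b) = ~~ positive (v, a).
  move=> va vb ab; rewrite -(positive_rev (d := (v, a)) va) /rev_dart /=.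
  have av : adj a v by rewrite adj_sym.
  have [_ _ cov] := other_nbrP av; rewrite -[RHS]positive_next /next_dart /= av.
  by case: (cov b vb) => [e|<-//]; rewrite e eqxx in ab.
rewrite /rotation; case: pickP => [w /andP [vw pw]|no] /=.
  split=> // x vx; apply: contraTeq => xw.
  by rewrite (turn w x) ?pw // eq_sym.
have [a [b [ab E]]] := two_nbrs v.
have va : adj v a by rewrite E eqxx.
have vb : adj v b by rewrite E eqxx orbT.
by have := no a; have := no b; rewrite va vb (turn a b) //=; case: (positive _).
Qed.

(** If [u] and [v] both went to [w], the successor [(w, v)] of the positive dart [(u, w)] would be
    positive along with its reverse. *)
Lemma rotation_inj : injective rotation.
Proof.
move=> u v E; apply/eqP/negPn/negP => uv.
have [uw pu _] := rotationP u; have [vw pv _] := rotationP v.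
set w := rotation u in uw pu E; rewrite -E in vw pv.
have := positive_rev (d := (v, w)) vw; rewrite pv /rev_dart /=.
have [_ _ cov] := other_nbrP uw.
case: (cov v); rewrite 1?adj_sym // => e; first by rewrite e eqxx in uv.
by have := positive_next (u, w); rewrite e /next_dart /= uw pu => ->.
Qed.

Lemma adj_rotation (x y : vert G) : adj x y = (y == rotation x) || (x == rotation y).
Proof.
apply/idP/idP => [xy|/orP [] /eqP ->]; last 2 first.
- by have [] := rotationP x.
- by rewrite adj_sym; have [] := rotationP y.
have [_ _ ux] := rotationP x; have [_ _ uy] := rotationP y.
have := positive_rev (d := (x, y)) xy; rewrite /rev_dart /=.
case pxy: (positive (x, y)) => /= pyx; first by rewrite (ux y) ?eqxx.
by rewrite (uy x) ?eqxx ?orbT // adj_sym.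
Qed.

End Rotation.

(** * Criteria for unboundedness by triples *)

(** Cliques extending [S1], [S2], [S3] form a good triple one level up, in [K H]. *)
Lemma meeting_triple_unbounded (H : graph) (s : vert H -> vert H) (S1 S2 S3 : {set vert H}) :
  coaffination s -> complete S1 -> complete S2 -> complete S3 ->
  S1 :&: S2 != set0 -> S1 :&: S3 != set0 -> S2 :&: S3 != set0 ->
  (forall T : vert (K H), two_of (fun S => val T :&: S != set0) S1 S2 S3) ->
  unbounded H.
Proof.
move=> cs /exists_clique [C1 sC1] /exists_clique [C2 sC2] /exists_clique [C3 sC3].
move=> m12 m13 m23 mT; have [x0 _] := set0Pn _ m12.
have [t ct _] := coaffinationK x0 cs; apply: unboundedK.
have meet (C D : vert (K H)) (S S' : {set vert H}) :
    S \subset val C -> S' \subset val D -> S :&: S' != set0 -> weq C D.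
  move=> /subsetP sC /subsetP sD /set0Pn [x /setIP [xS xS']].
  exact: weqK (sC x xS) (sD x xS').
have meetT (T C : vert (K H)) (S : {set vert H}) :
    S \subset val C -> val T :&: S != set0 -> weq T C.
  by apply: meet.
apply: (good_triple_unbounded ct (a := C1) (b := C2) (c := C3)).
apply/and4P; split; [exact: meet m12 | exact: meet m13 | exact: meet m23 |].
apply/forall_inP => T _; have := mT T; rewrite /two_of.
case/or3P => /andP [h1 h2].
- by rewrite (meetT T C1 S1) ?(meetT T C2 S2).
- by rewrite (meetT T C1 S1) ?(meetT T C3 S3) ?orbT.
- by rewrite (meetT T C2 S2) ?(meetT T C3 S3) ?orbT.
Qed.

Lemma weq_compl (G : graph) (x y : vert G) : weq (x : vert (compl G)) y = ~~ adj x y.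
Proof. by rewrite /weq /= /compl_adj; case: eqP => //= ->; rewrite adj_irr. Qed.

(** In a graph without isolated vertices this means disjoint closed neighbourhoods, that is,
    distance at least 3. *)
Definition far (G : graph) (x y : vert G) : Prop :=
  ~~ adj x y /\ forall v, ~~ (adj v x && adj v y).

(** Each vertex is adjacent in [G] to at most one of [a], [b], [c], hence [weq] in the complement to
    the other two. *)
Lemma far_triple_unbounded (G : graph) (s : vert G -> vert G) (a b c : vert G) :
  @coaffination (compl G) s -> far a b -> far a c -> far b c -> unbounded (compl G).
Proof.
move=> cs [nab fab] [nac fac] [nbc fbc].
apply: (@good_triple_unbounded (compl G) s a b c cs).
apply/and4P; rewrite !weq_compl; split=> //; apply/forall_inP => v _.
rewrite /two_of !weq_compl.
by move: (fab v) (fac v) (fbc v); case: adj; case: adj; case: adj.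
Qed.

Lemma meets4 (T : finType) (A : {set T}) (a b c d : T) :
  (A :&: [set a; b; c; d] != set0) = [|| a \in A, b \in A, c \in A | d \in A].
Proof.
apply/set0Pn/or4P => [[x /setIP [xA]]|].
  by rewrite !inE -!orbA => /or4P [] /eqP <-; [constructor 1|constructor 2|constructor 3|constructor 4].
by case=> h; [exists a | exists b | exists c | exists d]; rewrite !inE h eqxx ?orbT.
Qed.

(** * Complements of unions of cycles *)

Section CyclicOrientation.

Variables (G : graph) (s : vert G -> vert G).
Hypothesis injs : injective s.
Hypothesis adjE : forall x y, adj x y = (y == s x) || (x == s y).

Lemma coaffination_compl : @coaffination (compl G) s.
Proof.
split=> // [x y|x]; last by rewrite weq_compl adjE eqxx.
by rewrite /= /compl_adj !adjE !(inj_eq injs).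
Qed.

Lemma iter_neq (x : vert G) (i j : nat) :
  i < j -> j < order s x -> iter i s x <> iter j s x.
Proof.
move=> ij jo E; have io := ltn_trans ij jo.
by move: ij; rewrite -(findex_iter io) E findex_iter ?ltnn.
Qed.

Lemma order_step (x : vert G) : order s (s x) = order s x.
Proof. by rewrite /order; apply: eq_card => z; rewrite !inE -same_fconnect1. Qed.

Lemma not_adj_iter (x : vert G) (d : nat) :
  1 < d -> d.+1 < order s x -> ~~ adj x (iter d s x).
Proof.
move=> d1 dx; rewrite adjE; apply/negP => /orP [] /eqP E.
  by apply: (iter_neq d1 (ltnW dx)); rewrite E.
by apply: (@iter_neq x 0 d.+1).
Qed.

(** Both arcs have length at least 3. A common neighbour would identify two of the iterates of [x]
    with exponents up to [d.+2]. *)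
Lemma far_iter (x : vert G) (d : nat) :
  2 < d -> d.+2 < order s x -> far x (iter d s x).
Proof.
move=> d2 dx; split; first by apply: not_adj_iter; rewrite ltnW.
have inj i j : i < j -> j <= d.+2 -> iter i s x <> iter j s x.
  by move=> ij jd; apply: iter_neq ij (leq_ltn_trans jd dx).
move=> v; rewrite !adjE; apply/negP => /andP [].
case/orP => /eqP e1 /orP [] /eqP e2.
- by apply: (inj 0 d _ _); rewrite /= ?e2 -?e1 // ?(leq_trans _ d2) // !leqW.
- by apply: (inj 0 d.+2 _ _); rewrite //= -e2.
- by apply: (inj 2 d _ _); rewrite /= ?e2 -?e1 // !leqW.
- by apply: (inj 1 d.+1 _ _); rewrite /= -?e2 ?e1 // ltnS ltnW // ltnW.
Qed.

Lemma adj_fconnect (x y : vert G) : adj x y -> fconnect s x y.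
Proof.
rewrite adjE => /orP [] /eqP ->; first exact: fconnect1.
by rewrite fconnect_sym // fconnect1.
Qed.

Lemma far_disconnected (x y : vert G) : ~~ fconnect s x y -> far x y.
Proof.
move=> nxy; split; first by apply: contra nxy; apply: adj_fconnect.
move=> v; apply: contra nxy => /andP [/adj_fconnect vx /adj_fconnect].
by apply: connect_trans; rewrite fconnect_sym.
Qed.

Lemma disconnected_iter (x y : vert G) :
  ~~ fconnect s x y -> forall i j, ~~ fconnect s (iter i s x) (iter j s y).
Proof.
move=> nxy i j; apply: contra nxy => xy.
apply: connect_trans (fconnect_iter s i x) (connect_trans xy _).
by rewrite fconnect_sym // fconnect_iter.
Qed.

Lemma independent4 (a b c d : vert G) :
  ~~ adj a b -> ~~ adj c d -> ~~ fconnect s a c -> fconnect s a b -> fconnect s c d ->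
  complete ([set a; b; c; d] : {set vert (compl G)}).
Proof.
move=> nab ncd nac ab cd.
have cross u v : fconnect s a u -> fconnect s c v -> ~~ adj u v.
  move=> au cv; apply: contra nac => /adj_fconnect uv.
  by apply: connect_trans au (connect_trans uv _); rewrite fconnect_sym.
have [ac ad bc bd] : [/\ ~~ adj a c, ~~ adj a d, ~~ adj b c & ~~ adj b d].
  by rewrite !cross.
apply/completeP => x y; rewrite weq_compl !inE -!orbA.
by case/or4P => /eqP -> /or4P [] /eqP ->; rewrite ?adj_irr // adj_sym.
Qed.

(** [T] is a maximal independent set of [G]: if it missed three consecutive vertices, the middle one
    could be added. *)
Lemma clique_step (T : vert (K (compl G))) (v : vert G) :
  ~~ ((v \in val T) && (s v \in val T)) &&
  [|| v \in val T, s v \in val T | s (s v) \in val T].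
Proof.
apply/andP; split.
  apply/negP => /andP [vT svT].
  have /completeP /(_ v (s v) vT svT) := clique_complete T.
  by rewrite weq_compl adjE eqxx.
rewrite orbCA; case sT: (s v \in val T) => //=; apply/negPn/negP; rewrite negb_or.
move=> /andP [nv nssv]; have /negP := negbT sT; apply; apply: (@clique_maximal (compl G)) => u uT.
rewrite weq_compl adjE (inj_eq injs).
apply/norP; split; apply/eqP => e; first by rewrite -e uT in nssv.
by rewrite e uT in nv.
Qed.

(** The booleans record which cycle vertices lie in a clique [T], [ok] is [clique_step], and each
    [c] says that [T] meets one of the three chosen sets. *)
Lemma bool_C4_C5 (x0 x1 x2 x3 y0 y1 y2 y3 y4 : bool) :
  let ok a b c := ~~ (a && b) && [|| a, b | c] in
  let c1 := [|| x0, x2, y0 | y2] in let c2 := [|| x1, x3, y2 | y4] in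
  let c3 := [|| x0, x2, y1 | y4] in
  ok x0 x1 x2 -> ok x1 x2 x3 -> ok x2 x3 x0 -> ok x3 x0 x1 ->
  ok y0 y1 y2 -> ok y1 y2 y3 -> ok y2 y3 y4 -> ok y3 y4 y0 -> ok y4 y0 y1 ->
  [|| c1 && c2, c1 && c3 | c2 && c3].
Proof.
case: x0; case: x1; case: x2; case: x3 => //;
by case: y0; case: y1; case: y2; case: y3; case: y4.
Qed.

Lemma bool_C5_C5 (x0 x1 x2 x3 x4 y0 y1 y2 y3 y4 : bool) :
  let ok a b c := ~~ (a && b) && [|| a, b | c] in
  let c1 := [|| x0, x2, y0 | y2] in let c2 := [|| x0, x3, y1 | y4] in
  let c3 := [|| x1, x3, y0 | y3] in
  ok x0 x1 x2 -> ok x1 x2 x3 -> ok x2 x3 x4 -> ok x3 x4 x0 -> ok x4 x0 x1 ->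
  ok y0 y1 y2 -> ok y1 y2 y3 -> ok y2 y3 y4 -> ok y3 y4 y0 -> ok y4 y0 y1 ->
  [|| c1 && c2, c1 && c3 | c2 && c3].
Proof.
case: x0; case: x1; case: x2; case: x3; case: x4 => //;
by case: y0; case: y1; case: y2; case: y3; case: y4.
Qed.

(* A maximal independent set of C_4 + C_5 is given by a class mod 2 and a pair
   {y_j, y_(j+2)}; under disjointness these sets form a 10-cycle, where we take
   three vertices at mutual distance at least 3. *)
Lemma C4_C5_unbounded (x y : vert G) :
  order s x = 4 -> order s y = 5 -> ~~ fconnect s x y -> unbounded (compl G).
Proof.
move=> ox oy nxy.
have conn := disconnected_iter nxy.
have x4 : s (s (s (s x))) = x by rewrite -[RHS](iter_order injs) ox.
have y5 : s (s (s (s (s y)))) = y by rewrite -[RHS](iter_order injs) oy.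
pose X i : vert (compl G) := iter i s x; pose Y i : vert (compl G) := iter i s y.
apply: (@meeting_triple_unbounded (compl G) s [set X 0; X 2; Y 0; Y 2]
  [set X 1; X 3; Y 2; Y 4] [set X 0; X 2; Y 1; Y 4] coaffination_compl).
- apply: independent4; rewrite ?(conn 0 0) ?(fconnect_iter s 2) //;
    by apply: (@not_adj_iter _ 2); rewrite ?ox ?oy.
- apply: independent4; rewrite ?(conn 1 2) ?(fconnect_iter s 2) //;
    by apply: (@not_adj_iter _ 2); rewrite /X /Y /= ?order_step ?ox ?oy.
- apply: independent4; rewrite ?(conn 0 1) ?(fconnect_iter s 2) ?(fconnect_iter s 3) //.
    by apply: (@not_adj_iter _ 2); rewrite ?ox.
  by apply: (@not_adj_iter _ 3); rewrite /Y /= ?order_step ?oy.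
- by rewrite meets4 !inE eqxx ?orbT.
- by rewrite meets4 !inE eqxx ?orbT.
- by rewrite meets4 !inE eqxx ?orbT.
move=> T; rewrite /two_of !meets4.
have cX i := clique_step T (X i); have cY i := clique_step T (Y i).
apply: bool_C4_C5 (cX 0) (cX 1) _ _ (cY 0) (cY 1) (cY 2) _ _.
- by have := cX 2; rewrite /X /= x4.
- by have := cX 3; rewrite /X /= x4.
- by have := cY 3; rewrite /Y /= y5.
- by have := cY 4; rewrite /Y /= y5.
Qed.

(* Here the maximal independent sets {x_i, x_(i+2), y_j, y_(j+2)} form, under
   disjointness, a 5 x 5 toroidal grid, and the witnesses (i, j) = (0, 0),
   (3, 4), (1, 3) are at mutual distance 3. *)
Lemma C5_C5_unbounded (x y : vert G) :
  order s x = 5 -> order s y = 5 -> ~~ fconnect s x y -> unbounded (compl G).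
Proof.
move=> ox oy nxy.
have conn := disconnected_iter nxy.
have x5 : s (s (s (s (s x)))) = x by rewrite -[RHS](iter_order injs) ox.
have y5 : s (s (s (s (s y)))) = y by rewrite -[RHS](iter_order injs) oy.
pose X i : vert (compl G) := iter i s x; pose Y i : vert (compl G) := iter i s y.
apply: (@meeting_triple_unbounded (compl G) s [set X 0; X 2; Y 0; Y 2]
  [set X 0; X 3; Y 1; Y 4] [set X 1; X 3; Y 0; Y 3] coaffination_compl).
- apply: independent4; rewrite ?(conn 0 0) ?(fconnect_iter s 2) //;
    by apply: (@not_adj_iter _ 2); rewrite ?ox ?oy.
- apply: independent4; rewrite ?(conn 0 1) ?(fconnect_iter s 3) //;
    by apply: (@not_adj_iter _ 3); rewrite /X /Y /= ?order_step ?ox ?oy.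
- apply: independent4; rewrite ?(conn 1 0) ?(fconnect_iter s 2) ?(fconnect_iter s 3) //.
    by apply: (@not_adj_iter _ 2); rewrite /X /= ?order_step ?ox.
  by apply: (@not_adj_iter _ 3); rewrite ?oy.
- by rewrite meets4 !inE eqxx ?orbT.
- by rewrite meets4 !inE eqxx ?orbT.
- by rewrite meets4 !inE eqxx ?orbT.
move=> T; rewrite /two_of !meets4.
have cX i := clique_step T (X i); have cY i := clique_step T (Y i).
apply: bool_C5_C5 (cX 0) (cX 1) (cX 2) _ _ (cY 0) (cY 1) (cY 2) _ _.
- by have := cX 3; rewrite /X /= x5.
- by have := cX 4; rewrite /X /= x5.
- by have := cY 3; rewrite /Y /= y5.
- by have := cY 4; rewrite /Y /= y5.
Qed.

Lemma cyclic_orientation_unbounded : 8 < #|vert G| -> unbounded (compl G).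
Proof.
move=> n9; have cs := coaffination_compl.
have outside (A : {pred vert G}) : #|A| < #|vert G| -> exists z, z \notin A.
  move=> ltA; apply/existsP; apply: contraTT ltA => /existsPn allA.
  by rewrite -leqNgt; apply/subset_leq_card/subsetP => z _; apply/negPn/allA.
(* A cycle of length at least 9 contains the far triple at positions 0, 3, 6. *)
have [/existsP [x ox]|/existsPn o9] := boolP [exists x, 8 < order s x].
  apply: (far_triple_unbounded cs (far_iter (x := x) (d := 3) _ _)
    (far_iter (x := x) (d := 6) _ _) (far_iter (x := iter 3 s x) (d := 3) _ _)) => //=;
  by rewrite ?order_step; apply: leq_trans ox.
(* A cycle of length 6 to 8 has a far pair at positions 0, 3 and leaves out a vertex, far from
   both. *)
have [/existsP [x ox]|/existsPn o6] := boolP [exists x, 5 < order s x].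
  have [y nxy] : exists y, y \notin fconnect s x.
    by apply: outside; apply: leq_trans n9; rewrite ltnS leqNgt o9.
  apply: (far_triple_unbounded cs (far_iter (x := x) (d := 3) _ _)
    (far_disconnected nxy) (far_disconnected _)) => //.
  by rewrite /= -!same_fconnect1.
have o5 z : order s z <= 5 by rewrite leqNgt o6.
have [x _] : exists x : vert G, x \notin pred0 by apply: outside; rewrite card0; apply: leq_trans n9.
have [y nxy] : exists y, y \notin fconnect s x.
  by apply: outside; apply: leq_trans n9; apply: leq_ltn_trans (o5 x) _.
(* Three cycles give a far triple with one vertex on each. *)
have [/existsP [z]|/existsPn cov] := boolP [exists z, ~~ (fconnect s x z || fconnect s y z)].
  rewrite negb_or => /andP [nxz nyz].
  exact: far_triple_unbounded cs (far_disconnected nxy) (far_disconnected nxz) (far_disconnected nyz).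
have sum : 8 < order s x + order s y.
  apply: leq_trans n9 _; rewrite /order -cardUI.
  apply: leq_trans (leq_addr _ _); apply/subset_leq_card/subsetP => z _.
  exact: negbNE (cov z).
have nyx : ~~ fconnect s y x by rewrite fconnect_sym.
(* Two lengths of at most 5 with sum at least 9 are 4 and 5 in either order, or 5 and 5. *)
move: sum (o5 x) (o5 y).
case ox: (order s x) => [|[|[|[|[|[|//]]]]]]; case oy: (order s y) => [|[|[|[|[|[|//]]]]]] // _ _ _.
- exact: C4_C5_unbounded ox oy nxy.
- exact: C4_C5_unbounded oy ox nyx.
- exact: C5_C5_unbounded ox oy nxy.
Qed.

End CyclicOrientation.

Theorem mainTheorem2 (G : graph) (n : nat) :
  regular G 2 -> #|vert G| = n -> 9 <= n -> divergent (compl G).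
Proof.
move=> regG <- n9; apply: unbounded_divergent.
exact: cyclic_orientation_unbounded (rotation_inj regG) (adj_rotation regG) n9.
Qed.
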